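(* A De Morgan clone $\mathsf C$ with $\mathsf{DMA}\subseteq\mathsf C$ is selfextensional if and only if $\mathsf C\subseteq\langle\mathsf{DMA},\partial\rangle$, i.e. if and only if every function in $\mathsf C$ is harmonious.
   Context: Let $\mathrm{DM}_4=\{\mathsf t,\mathsf f,\mathsf n,\mathsf b\}$, with truth order $\le$ ($\mathsf f$ least, $\mathsf t$ greatest, $\mathsf n,\mathsf b$ incomparable; meet $\wedge$, join $\vee$), De Morgan negation $-\mathsf t=\mathsf f$, $-\mathsf f=\mathsf t$, $-\mathsf n=\mathsf n$, $-\mathsf b=\mathsf b$, and conflation $\partial\mathsf t=\mathsf t$, $\partial\mathsf f=\mathsf f$, $\partial\mathsf n=\mathsf b$, $\partial\mathsf b=\mathsf n$. A De Morgan function is a map $\mathrm{DM}_4^n\to\mathrm{DM}_4$, $n\ge1$; a De Morgan clone is a set of such functions closed under composition and containing all projections; constants are unary constant functions. $\mathsf{DMA}$ is the clone generated by $\wedge,\vee,\mathsf t,\mathsf f,-$, and $\langle\mathsf{DMA},\partial\rangle$ the clone generated by $\mathsf{DMA}\cup\{\partial\}$. $f$ is harmonious if $f(\partial\overline a)=\partial f(\overline a)$ for all tuples $\overline a$. For sets $\Gamma(\overline x),\Theta(\overline x)\subseteq\mathsf C$, $\Gamma\vdash\Theta$ means: for every tuple $\overline a$ in $\mathrm{DM}_4$, $\Gamma(\overline a)\subseteq\{\mathsf t,\mathsf b\}$ implies $\Theta(\overline a)\subseteq\{\mathsf t,\mathsf b\}$; $\Gamma\dashv\vdash\Theta$ means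 both directions hold. $\mathsf C$ is selfextensional if for all $f,g,h\in\mathsf C$ with $f,g$ of the same arity, $f(\overline y)\dashv\vdash g(\overline y)$ implies $h(\overline x,f(\overline y),\overline z)\dashv\vdash h(\overline x,g(\overline y),\overline z)$. *)

(* Defs.v *)
From HB Require Import structures.
From mathcomp Require Import all_boot all_order.

Set Implicit Arguments.
Unset Strict Implicit.
Unset Printing Implicit Defensive.

Local Open Scope order_scope.

Inductive DM4 : Set := DMt | DMf | DMn | DMb.

Definition dm4_code (x : DM4) : bool * bool :=
  match x with
  | DMt => (true, true)
  | DMf => (false, false)
  | DMn => (true, false)
  | DMb => (false, true)
  end.

Definition dm4_decode (c : bool * bool) : DM4 :=
  match c with
  | (true, true) => DMt
  | (false, false) => DMf
  | (true, false) => DMn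
  | (false, true) => DMb
  end.

Fact dm4_codeK : cancel dm4_code dm4_decode. Proof. by case. Qed.

HB.instance Definition _ := Finite.copy DM4 (can_type dm4_codeK).

(* The truth order, with its meet and join tables.  The lattice instance below
   certifies that the tables are the infima and suprema of [dm4_le]; the
   symbols [<=], [`&`], [`|`], [\top], [\bot] on [DM4] refer to this order. *)
Definition dm4_le (x y : DM4) : bool := [|| x == DMf, y == DMt | x == y].

Definition dm4_meet (x y : DM4) : DM4 :=
  match x, y with
  | DMt, z | z, DMt => z
  | DMn, DMn => DMn
  | DMb, DMb => DMb
  | _, _ => DMf
  end.

Definition dm4_join (x y : DM4) : DM4 :=
  match x, y with
  | DMf, z | z, DMf => z
  | DMn, DMn => DMn
  | DMb, DMb => DMb
  | _, _ => DMt
  end.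

Fact dm4_display : Order.disp_t. Proof. exact: Order.Disp tt tt. Qed.

Fact dm4_le_def x y : dm4_le x y = (dm4_meet x y == x).
Proof. by case: x; case: y. Qed.
Fact dm4_meetC : commutative dm4_meet. Proof. by do 2!case. Qed.
Fact dm4_joinC : commutative dm4_join. Proof. by do 2!case. Qed.
Fact dm4_meetA : associative dm4_meet. Proof. by do 3!case. Qed.
Fact dm4_joinA : associative dm4_join. Proof. by do 3!case. Qed.
Fact dm4_joinKI y x : dm4_meet x (dm4_join x y) = x.
Proof. by case: x; case: y. Qed.
Fact dm4_meetKU y x : dm4_join x (dm4_meet x y) = x.
Proof. by case: x; case: y. Qed.
Fact dm4_meetUl : left_distributive dm4_meet dm4_join.
Proof. by do 3!case. Qed.
Fact dm4_meetxx : idempotent_op dm4_meet. Proof. by case. Qed.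

HB.instance Definition _ := Order.isMeetJoinDistrLattice.Build dm4_display DM4
  dm4_le_def (fun _ _ => erefl) dm4_meetC dm4_joinC dm4_meetA dm4_joinA
  dm4_joinKI dm4_meetKU dm4_meetUl dm4_meetxx.

Fact dm4_le0x (x : DM4) : DMf <= x. Proof. by case: x. Qed.
Fact dm4_lex1 (x : DM4) : x <= DMt. Proof. by case: x. Qed.

HB.instance Definition _ := Order.hasBottom.Build dm4_display DM4 dm4_le0x.
HB.instance Definition _ := Order.hasTop.Build dm4_display DM4 dm4_lex1.

Definition dm4_neg (x : DM4) : DM4 :=
  match x with DMt => DMf | DMf => DMt | DMn => DMn | DMb => DMb end.

Definition dm4_conf (x : DM4) : DM4 :=
  match x with DMt => DMt | DMf => DMf | DMn => DMb | DMb => DMn end.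

Definition designated : {set DM4} := [set DMt; DMb].

Definition dmtuple (n : nat) := {ffun 'I_n -> DM4}.

(* The type allows n = 0; positivity of arities is imposed by [is_clone]. *)
Definition dmfun (n : nat) := {ffun dmtuple n -> DM4}.

Definition dmfamily := forall n : nat, dmfun n -> Prop.

Definition family_sub (C D : dmfamily) : Prop :=
  forall (n : nat) (f : dmfun n), C n f -> D n f.

Definition dm_proj (n : nat) (i : 'I_n) : dmfun n := [ffun a : dmtuple n => a i].

Definition dm_comp (m n : nat) (h : dmfun m) (g : 'I_m -> dmfun n) : dmfun n :=
  [ffun a : dmtuple n => h [ffun i => g i a]].

Definition is_clone (C : dmfamily) : Prop :=
  [/\ forall (n : nat) (f : dmfun n), C n f -> (0 < n)%N,
      forall (n : nat) (i : 'I_n), C n (dm_proj i)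
    & forall (m n : nat) (h : dmfun m) (g : 'I_m -> dmfun n),
        C m h -> (forall i, C n (g i)) -> C n (dm_comp h g)].

Definition clone_gen (G : dmfamily) : dmfamily := fun n f =>
  forall C : dmfamily, is_clone C -> family_sub G C -> C n f.

Definition dm_meet : dmfun 2 := [ffun a : dmtuple 2 => a ord0 `&` a ord_max].
Definition dm_join : dmfun 2 := [ffun a : dmtuple 2 => a ord0 `|` a ord_max].
Definition dm_const (c : DM4) : dmfun 1 := [ffun=> c].
Definition dm_neg : dmfun 1 := [ffun a : dmtuple 1 => dm4_neg (a ord0)].
Definition dm_conf : dmfun 1 := [ffun a : dmtuple 1 => dm4_conf (a ord0)].

Inductive DMA_basis : dmfamily :=
  | DMA_meet : DMA_basis dm_meet
  | DMA_join : DMA_basis dm_join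
  | DMA_true : DMA_basis (dm_const DMt)
  | DMA_false : DMA_basis (dm_const DMf)
  | DMA_neg : DMA_basis dm_neg.

Definition DMA : dmfamily := clone_gen DMA_basis.

Inductive DMA_conf_basis : dmfamily :=
  | DMA_conf_DMA n (f : dmfun n) : DMA f -> DMA_conf_basis f
  | DMA_conf_conf : DMA_conf_basis dm_conf.

Definition DMA_conf : dmfamily := clone_gen DMA_conf_basis.

Definition harmonious (n : nat) (f : dmfun n) : Prop :=
  forall a : dmtuple n, f [ffun i => dm4_conf (a i)] = dm4_conf (f a).

(* The right-hand side is read conjunctively. *)
Definition entails (n : nat) (Gamma Theta : {set dmfun n}) : Prop :=
  forall a : dmtuple n,
    [set f a | f : dmfun n in Gamma] \subset designated ->
    [set g a | g : dmfun n in Theta] \subset designated.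

Definition interderivable (n : nat) (Gamma Theta : {set dmfun n}) : Prop :=
  entails Gamma Theta /\ entails Theta Gamma.

(* [dm_plug h f] is the function h(x, f(y), z) of the k + n + l variables
   x = x_1 ... x_k, y = y_1 ... y_n, z = z_1 ... z_l; k and l may be 0. *)
Definition dm_plug (k l n : nat) (h : dmfun (k + (1 + l))) (f : dmfun n) :
    dmfun (k + (n + l)) :=
  [ffun a : dmtuple (k + (n + l)) =>
    h [ffun i : 'I_(k + (1 + l)) =>
        match split i with
        | inl p => a (lshift (n + l) p)
        | inr q =>
          match split q with
          | inl _ => f [ffun j : 'I_n => a (rshift k (lshift l j))]
          | inr r => a (rshift k (rshift n r))
          end
        end]].

Definition selfextensional (C : dmfamily) : Prop :=
  forall (k l n : nat) (h : dmfun (k + (1 + l))) (f g : dmfun n),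
    C _ h -> C _ f -> C _ g ->
    interderivable [set f] [set g] ->
    interderivable [set dm_plug h f] [set dm_plug h g].

(* Main.v *)
Require Import Defs.
From mathcomp Require Import all_boot all_order.

Set Implicit Arguments.
Unset Strict Implicit.
Unset Printing Implicit Defensive.

Local Open Scope order_scope.

(** Code [DM4] by pairs of Booleans as in [dm4_code]: [dm4_conf] swaps the two
    coordinates and the second one is designation.
    A harmonious function is determined by its first coordinate, hence by a
    Boolean function of [x] and [dm4_conf x]; as negation composed with
    conflation is Boolean complement, its disjunctive normal form lies in the
    clone generated by DMA and conflation.
    Since negation exchanges the coordinates up to complement, a clone above DMA
    is selfextensional only if its members are determined by their designated
    points; harmonious functions always are.  Conversely, if [f] is not
    harmonious, instantiating it with constants and two variables gives a binary
    [g] such that designation of [g(n, b)] differs from the first coordinate of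
    [g(b, n)].  Then [y /\ -y /\ (x \/ -x \/ g)] has the same designated points
    as [y /\ -y /\ (x \/ -x)] or as [y /\ -y], but differs from it at [(b, n)]. *)

(** * Generated clones and pointwise closure *)

Lemma clone_gen_clone (G : dmfamily) :
  (forall n (f : dmfun n), G n f -> (0 < n)%N) -> is_clone (clone_gen G).
Proof.
(* Positivity of arities passes to the intersection only if some clone contains [G]; the family of
   all functions of positive arity is one. *)
have pos_clone : is_clone (fun n _ => (0 < n)%N).
  by split=> // [n [i lt_in] | m n h g m_gt0 /(_ (Ordinal m_gt0))//];
     case: n lt_in.
move=> G_pos; split; first by move=> n f /(_ _ pos_clone); apply.
- by move=> n i C [_ projC _] _; apply: projC.
- move=> m n h g Gh Gg C cC GC; have [_ _ compC] := cC.
  by apply: compC => [|i]; [apply: Gh | apply: Gg].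
Qed.

Lemma clone_gen_basis (G : dmfamily) : family_sub G (clone_gen G).
Proof. by move=> n f Gf C _; apply. Qed.

Lemma clone_gen_sub (G D : dmfamily) :
  is_clone D -> family_sub G D -> family_sub (clone_gen G) D.
Proof. by move=> Dc GD n f; apply. Qed.

Section PointwiseClosure.

Variables (C : dmfamily) (C_clone : is_clone C).

Lemma clone_pos n (f : dmfun n) : C f -> (0 < n)%N.
Proof. by case: C_clone => pos _ _; apply: pos. Qed.

Lemma clone_proj n (i : 'I_n) : C (dm_proj i).
Proof. by case: C_clone. Qed.

Lemma clone_comp m n (h : dmfun m) (g : 'I_m -> dmfun n) :
  C h -> (forall i, C (g i)) -> C (dm_comp h g).
Proof. by case: C_clone => _ _; apply. Qed.

Lemma clone_unary (u : dmfun 1) (op : DM4 -> DM4) n (f : dmfun n) :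
  (forall a, u a = op (a ord0)) -> C u -> C f ->
  C [ffun a : dmtuple n => op (f a)].
Proof.
move=> uE Cu Cf; suff -> : [ffun a => op (f a)] = dm_comp u (fun=> f).
  exact: clone_comp.
by apply/ffunP => a; rewrite !ffunE uE ffunE.
Qed.

Lemma clone_binary (u : dmfun 2) (op : DM4 -> DM4 -> DM4) n (f g : dmfun n) :
  (forall a, u a = op (a ord0) (a ord_max)) -> C u -> C f -> C g ->
  C [ffun a : dmtuple n => op (f a) (g a)].
Proof.
move=> uE Cu Cf Cg; suff -> : [ffun a => op (f a) (g a)] =
    dm_comp u (fun i => if i == ord0 then f else g).
  by apply: clone_comp => // i; case: ifP.
by apply/ffunP => a; rewrite !ffunE uE !ffunE.
Qed.

Hypothesis DMA_C : family_sub DMA C.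

Lemma clone_meet n (f g : dmfun n) :
  C f -> C g -> C [ffun a : dmtuple n => f a `&` g a].
Proof.
apply: (@clone_binary dm_meet) => [a|]; first by rewrite ffunE.
by apply: DMA_C; apply: clone_gen_basis; constructor.
Qed.

Lemma clone_join n (f g : dmfun n) :
  C f -> C g -> C [ffun a : dmtuple n => f a `|` g a].
Proof.
apply: (@clone_binary dm_join) => [a|]; first by rewrite ffunE.
by apply: DMA_C; apply: clone_gen_basis; constructor.
Qed.

Lemma clone_neg n (f : dmfun n) :
  C f -> C [ffun a : dmtuple n => dm4_neg (f a)].
Proof.
apply: (@clone_unary dm_neg) => [a|]; first by rewrite ffunE.
by apply: DMA_C; apply: clone_gen_basis; constructor.
Qed.

(** Constants are unary, so they reach arity [n] through a projection, which exists because [n] is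
    positive. *)
Lemma clone_true n : (0 < n)%N -> C ([ffun=> DMt] : dmfun n).
Proof.
move=> n_gt0; have Cp := clone_proj (Ordinal n_gt0).
apply: (clone_unary (u := dm_const DMt) (op := fun=> DMt) _ _ Cp) => [a|].
  by rewrite ffunE.
by apply: DMA_C; apply: clone_gen_basis; constructor.
Qed.

Lemma clone_false n : (0 < n)%N -> C ([ffun=> DMf] : dmfun n).
Proof.
move=> n_gt0; have Cp := clone_proj (Ordinal n_gt0).
apply: (clone_unary (u := dm_const DMf) (op := fun=> DMf) _ _ Cp) => [a|].
  by rewrite ffunE.
by apply: DMA_C; apply: clone_gen_basis; constructor.
Qed.

Lemma clone_bigmeet n (I : Type) (r : seq I) (P : pred I) (F : I -> dmfun n) :
  (0 < n)%N -> (forall i, C (F i)) ->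
  C [ffun a : dmtuple n => \meet_(i <- r | P i) F i a].
Proof.
move=> n_gt0 CF; elim: r => [|i r IHr].
  rewrite (_ : finfun _ = [ffun=> DMt]); first exact: clone_true.
  by apply/ffunP => a; rewrite !ffunE big_nil.
case Pi: (P i); last first.
  rewrite (_ : finfun _ = [ffun a => \meet_(i <- r | P i) F i a]) //.
  by apply/ffunP => a; rewrite !ffunE big_cons Pi.
rewrite (_ : finfun _ =
  [ffun a => F i a `&` [ffun a => \meet_(i <- r | P i) F i a] a]).
  exact: clone_meet.
by apply/ffunP => a; rewrite !ffunE big_cons Pi.
Qed.

Lemma clone_bigjoin n (I : Type) (r : seq I) (P : pred I) (F : I -> dmfun n) :
  (0 < n)%N -> (forall i, C (F i)) ->
  C [ffun a : dmtuple n => \join_(i <- r | P i) F i a].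
Proof.
move=> n_gt0 CF; elim: r => [|i r IHr].
  rewrite (_ : finfun _ = [ffun=> DMf]); first exact: clone_false.
  by apply/ffunP => a; rewrite !ffunE big_nil.
case Pi: (P i); last first.
  rewrite (_ : finfun _ = [ffun a => \join_(i <- r | P i) F i a]) //.
  by apply/ffunP => a; rewrite !ffunE big_cons Pi.
rewrite (_ : finfun _ =
  [ffun a => F i a `|` [ffun a => \join_(i <- r | P i) F i a] a]).
  exact: clone_join.
by apply/ffunP => a; rewrite !ffunE big_cons Pi.
Qed.

End PointwiseClosure.

Lemma DMA_basis_pos n (f : dmfun n) : DMA_basis f -> (0 < n)%N.
Proof. by case. Qed.

Lemma DMA_clone : is_clone DMA.
Proof. by apply: clone_gen_clone => n f; apply: DMA_basis_pos. Qed.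

Lemma DMA_conf_clone : is_clone DMA_conf.
Proof.
by apply: clone_gen_clone => _ _ [n f /(clone_pos DMA_clone)|].
Qed.

Lemma DMA_sub_DMA_conf : family_sub DMA DMA_conf.
Proof. by move=> n f fD; apply: clone_gen_basis; constructor. Qed.

(** * Conflation and normal forms of harmonious functions *)

Definition conf_tuple n (a : dmtuple n) : dmtuple n := [ffun i => dm4_conf (a i)].

Lemma dm4_confK : involutive dm4_conf. Proof. by case. Qed.

Lemma conf_tupleK n : involutive (@conf_tuple n).
Proof. by move=> a; apply/ffunP => i; rewrite !ffunE dm4_confK. Qed.

Lemma harmonious_clone : is_clone (fun n f => (0 < n)%N /\ harmonious f).
Proof.
split=> [n f [] // | n i | m n h g [m_gt0 hh] gh].
  split=> [|a]; first exact: leq_ltn_trans (ltn_ord i).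
  by rewrite !ffunE.
split=> [|a]; first by have [] := gh (Ordinal m_gt0).
rewrite !ffunE -hh; congr (h _); apply/ffunP => i; rewrite !ffunE.
by have [_ ->] := gh i.
Qed.

Lemma DMA_conf_harmonious n (f : dmfun n) : DMA_conf f -> harmonious f.
Proof.
(* Adding positivity of the arity turns the goal into membership in a clone, so minimality applies,
   first for [DMA_conf] and then for [DMA]. *)
move=> fD; apply: proj2 _; move: n f fD.
apply: (clone_gen_sub harmonious_clone) => _ _ [n f|]; last first.
  by split=> // a; rewrite !ffunE.
move: n f; apply: (clone_gen_sub harmonious_clone) => _ _ [];
  split=> // a; rewrite !ffunE //;
  by case: (a ord0) => //; case: (a ord_max).
Qed.

(** A two-valued indicator of [c] is not harmonious when [c] is [DMn] or [DMb]; here the first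
    coordinate is the indicator and harmony forces the second. *)
Definition dm4_lit (c x : DM4) : DM4 := dm4_decode (x == c, dm4_conf x == c).

Lemma DMA_conf_lit n (i : 'I_n) c :
  DMA_conf [ffun a : dmtuple n => dm4_lit c (a i)].
Proof.
pose Cc := DMA_conf_clone; pose sC := DMA_sub_DMA_conf.
have Cx := clone_proj Cc i.
have Cconf (f : dmfun n) : DMA_conf f ->
    DMA_conf [ffun a : dmtuple n => dm4_conf (f a)].
  apply: (clone_unary Cc (u := dm_conf)) => [a|]; first by rewrite ffunE.
  by apply: clone_gen_basis; constructor.
have CN f (Cf : DMA_conf f) := clone_neg Cc sC Cf.
have CI f g (Cf : DMA_conf f) (Cg : DMA_conf g) := clone_meet Cc sC Cf Cg.
have Cx' := Cconf _ Cx.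
(* [lit b f] complements both coordinates of [f] when [b] is false, so each coordinate tests
   equality with [b]. Both coordinates of [x] get tested against those of [c], as [dm4_conf x]
   brings the second one to the front. *)
pose lit b (f : dmfun n) : dmfun n :=
  if b then f else [ffun a => dm4_neg ([ffun a => dm4_conf (f a)] a)].
have Clit b f : DMA_conf f -> DMA_conf (lit b f).
  by rewrite /lit; case: b => // Cf; apply: CN (Cconf _ Cf).
suff -> : [ffun a : dmtuple n => dm4_lit c (a i)] = [ffun a =>
    lit (dm4_code c).1 (dm_proj i) a `&`
    lit (dm4_code c).2 [ffun a => dm4_conf (dm_proj i a)] a].
  exact: CI (Clit _ _ Cx) (Clit _ _ Cx').
by apply/ffunP => a; rewrite /lit; case: c; rewrite !ffunE /=; case: (a i).
Qed.

Lemma dm4_code_meet x y :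
  dm4_code (x `&` y) = ((dm4_code x).1 && (dm4_code y).1,
                        (dm4_code x).2 && (dm4_code y).2).
Proof. by case: x; case: y. Qed.

Lemma dm4_code_join x y :
  dm4_code (x `|` y) = ((dm4_code x).1 || (dm4_code y).1,
                        (dm4_code x).2 || (dm4_code y).2).
Proof. by case: x; case: y. Qed.

Lemma dm4_decodeK : cancel dm4_decode dm4_code.
Proof. by case=> [[] []]. Qed.

Lemma dm4_code_conf x :
  dm4_code (dm4_conf x) = ((dm4_code x).2, (dm4_code x).1).
Proof. by case: x. Qed.

Lemma dm4_code_bigmeet (I : finType) (P : pred I) (F : I -> DM4) :
  dm4_code (\meet_(i | P i) F i) =
  ([forall (i | P i), (dm4_code (F i)).1],
   [forall (i | P i), (dm4_code (F i)).2]).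
Proof.
rewrite -!big_andE.
by elim/big_rec3: _ => [|i x y z _ IH]; rewrite // dm4_code_meet IH.
Qed.

Lemma dm4_code_bigjoin (I : finType) (P : pred I) (F : I -> DM4) :
  dm4_code (\join_(i | P i) F i) =
  ([exists (i | P i), (dm4_code (F i)).1],
   [exists (i | P i), (dm4_code (F i)).2]).
Proof.
rewrite -!big_orE.
by elim/big_rec3: _ => [|i x y z _ IH]; rewrite // dm4_code_join IH.
Qed.

Lemma harmonious_DMA_conf n (f : dmfun n) :
  (0 < n)%N -> harmonious f -> DMA_conf f.
Proof.
move=> n_gt0 hf; pose Cc := DMA_conf_clone; pose sC := DMA_sub_DMA_conf.
(* [M c] is the minterm of [c]: in the first coordinate, the indicator of the tuple [c]. *)
pose M (c : dmtuple n) : dmfun n :=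
  [ffun a => \meet_(i < n) [ffun a : dmtuple n => dm4_lit (c i) (a i)] a].
have CM c : DMA_conf (M c).
  by apply: (clone_bigmeet Cc sC) => // i; apply: DMA_conf_lit.
have ME c a : dm4_code (M c a) = (a == c, conf_tuple a == c).
  rewrite ffunE dm4_code_bigmeet; congr (_, _).
    apply/forall_inP/eqP => [ac | -> i _]; last by rewrite ffunE dm4_decodeK /=.
    by apply/ffunP => i; have := ac i isT; rewrite ffunE dm4_decodeK => /eqP.
  apply/forall_inP/eqP => [ac | <- i _]; last by rewrite !ffunE dm4_decodeK /=.
  by apply/ffunP => i; have := ac i isT; rewrite !ffunE dm4_decodeK => /eqP.
suff -> : f = [ffun a => \join_(c | (dm4_code (f c)).1) M c a].
  exact: (clone_bigjoin Cc sC).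
apply/ffunP => a; rewrite ffunE.
apply: (can_inj dm4_codeK); rewrite dm4_code_bigjoin.
(* Only one minterm is nonzero in a given coordinate. The join thus has coordinates
   [(dm4_code (f a)).1] and [(dm4_code (f (conf_tuple a))).1]; by harmony the latter is the second
   coordinate of [f a]. *)
have exE (b : dmtuple n) (p : dmtuple n -> bool) :
    (forall c, p c = (b == c)) ->
    [exists (c | (dm4_code (f c)).1), p c] = (dm4_code (f b)).1.
  move=> pE; apply/exists_inP/idP => [[c fc] | fb].
    by rewrite pE => /eqP->.
  by exists b; rewrite // pE.
rewrite (exE a) => [|c]; last by rewrite ME.
rewrite (exE (conf_tuple a)) => [|c]; last by rewrite ME.
by rewrite hf dm4_code_conf /=; case: dm4_code.
Qed.

(** * Interderivability and selfextensional clones *)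

Lemma designatedE x : (x \in designated) = (dm4_code x).2.
Proof. by rewrite !inE; case: x. Qed.

Lemma interderivable1P n (f g : dmfun n) :
  interderivable [set f] [set g] <->
  (forall a, (f a \in designated) = (g a \in designated)).
Proof.
rewrite /interderivable /entails; split=> [[fg gf] a | fg].
  by apply/idP/idP; [move: (fg a) | move: (gf a)]; rewrite !imset_set1 !sub1set.
by split=> a; rewrite !imset_set1 !sub1set fg.
Qed.

(** Designation at [a] reads the second coordinate of the value; designation at [conf_tuple a]
    reads, by harmony, the first. *)
Lemma harmonious_interderivable n (f g : dmfun n) :
  harmonious f -> harmonious g -> interderivable [set f] [set g] -> f = g.
Proof.
move=> hf hg /interderivable1P fg; apply/ffunP => a.
have := fg a; have := fg (conf_tuple a); rewrite hf hg !designatedE.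
by case: (f a); case: (g a).
Qed.

(** Plugging into negation makes the first coordinate visible: [dm4_neg x] is designated exactly
    when the first coordinate of [x] is false. *)
Lemma selfextensional_interderivable (C : dmfamily) n (f g : dmfun n) :
  family_sub DMA C -> selfextensional C -> C n f -> C n g ->
  interderivable [set f] [set g] -> f = g.
Proof.
move=> DMA_C seC Cf Cg fg; apply/ffunP => a.
have CN : C (0 + (1 + 0))%N dm_neg.
  by apply: DMA_C; apply: clone_gen_basis; constructor.
have /interderivable1P Nfg := seC _ _ _ _ _ _ CN Cf Cg fg.
(* With no side variables the plugged function has arity [0 + (n + 0)], so [a] is recast to that
   index type. *)
pose a' : dmtuple (0 + (n + 0)) := [ffun i => a (cast_ord (addn0 n) i)].
have plugE u : dm_plug (k := 0) (l := 0) dm_neg u a' = dm4_neg (u a).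
  rewrite !ffunE; case: splitP => [[] // | q q0].
  case: splitP => [_ _ | [] //]; congr (dm4_neg (u _)); apply/ffunP => j.
  by rewrite !ffunE; congr (a _); apply: val_inj.
move/interderivable1P/(_ a): fg; move: (Nfg a'); rewrite !plugE !designatedE.
by case: (f a); case: (g a).
Qed.

Definition dm_pair (x y : DM4) : dmtuple 2 := [ffun i => if i == ord0 then x else y].

Lemma selfextensional_binary (C : dmfamily) (g : dmfun 2) :
  is_clone C -> family_sub DMA C -> selfextensional C -> C 2 g ->
  (dm4_code (g (dm_pair DMn DMb))).2 = (dm4_code (g (dm_pair DMb DMn))).1.
Proof.
move=> Cc sC seC Cg.
have pairE (a : dmtuple 2) : a = dm_pair (a ord0) (a ord_max).
  apply/ffunP => i; rewrite ffunE; case: eqP => [-> // | /eqP i_neq0].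
  by congr (a _); apply: val_inj; case: i i_neq0 => [[|[|]]].
have CN f (Cf : C 2 f) := clone_neg Cc sC Cf.
have CI f h (Cf : C 2 f) (Ch : C 2 h) := clone_meet Cc sC Cf Ch.
have CU f h (Cf : C 2 f) (Ch : C 2 h) := clone_join Cc sC Cf Ch.
have Cx := clone_proj Cc (ord0 : 'I_2).
have Cy := clone_proj Cc (ord_max : 'I_2).
have [u uE Cu] : exists2 u : dmfun 2,
    forall x y, u (dm_pair x y) = y `&` dm4_neg y & C 2 u.
  exists [ffun a => dm_proj ord_max a `&` [ffun a => dm4_neg (dm_proj ord_max a)] a].
    by move=> x y; rewrite !ffunE.
  exact: CI (CN _ Cy).
have [v vE Cv] : exists2 v : dmfun 2,
    forall x y, v (dm_pair x y) = x `|` dm4_neg x & C 2 v.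
  exists [ffun a => dm_proj ord0 a `|` [ffun a => dm4_neg (dm_proj ord0 a)] a].
    by move=> x y; rewrite !ffunE.
  exact: CU (CN _ Cx).
(* [u] is designated only for [y = DMb], and [v] fails to be only for [x = DMn]. Hence [u], [s] and
   [r] can differ in designation only at [(DMn, DMb)], where [g] decides for [r]. *)
pose s : dmfun 2 := [ffun a => u a `&` v a].
pose r : dmfun 2 := [ffun a => u a `&` [ffun a => v a `|` g a] a].
have Cs : C 2 s := CI _ _ Cu Cv.
have Cr : C 2 r := CI _ _ Cu (CU _ _ Cv Cg).
have sE x y : s (dm_pair x y) = (y `&` dm4_neg y) `&` (x `|` dm4_neg x).
  by rewrite ffunE uE vE.
have rE x y : r (dm_pair x y) =
    (y `&` dm4_neg y) `&` ((x `|` dm4_neg x) `|` g (dm_pair x y)).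
  by rewrite !ffunE uE vE.
have seE f h (Cf : C 2 f) (Ch : C 2 h) :
    (forall x y, (dm4_code (f (dm_pair x y))).2 = (dm4_code (h (dm_pair x y))).2) ->
    f (dm_pair DMb DMn) = h (dm_pair DMb DMn).
  move=> fh; suff -> : f = h by [].
  apply: (selfextensional_interderivable sC seC Cf Ch).
  by apply/interderivable1P => a; rewrite !designatedE (pairE a).
case gnb: (dm4_code _).2; case gbn: (dm4_code _).1 => //.
(* At [(DMb, DMn)], [r] is [DMf] but [u] is [DMn]. *)
- have : r (dm_pair DMb DMn) = u (dm_pair DMb DMn).
    apply: seE => // x y; rewrite rE uE dm4_code_meet dm4_code_join.
    by case: y; case: x; rewrite ?gnb.
  by rewrite rE uE; case: (g _) gbn.
(* At [(DMb, DMn)], [r] is [DMn] but [s] is [DMf]. *)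
- have : r (dm_pair DMb DMn) = s (dm_pair DMb DMn).
    apply: seE => // x y; rewrite rE sE !dm4_code_meet dm4_code_join.
    by case: y; case: x; rewrite ?gnb.
  by rewrite rE sE; case: (g _) gbn.
Qed.

Lemma selfextensional_harmonious (C : dmfamily) n (f : dmfun n) :
  is_clone C -> family_sub DMA C -> selfextensional C -> C n f -> harmonious f.
Proof.
move=> Cc sC seC Cf a.
have key (b : dmtuple n) : (dm4_code (f b)).2 = (dm4_code (f (conf_tuple b))).1.
  (* These substitutions yield [b] at [(DMn, DMb)] and [conf_tuple b] at [(DMb, DMn)]. *)
  pose s i : dmfun 2 := match b i with
    | DMt => [ffun=> DMt] | DMf => [ffun=> DMf]
    | DMn => dm_proj ord0 | DMb => dm_proj ord_max end.
  have Cs i : C 2 (s i).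
    rewrite /s; case: (b i); first exact: clone_true.
    - exact: clone_false.
    - exact: clone_proj.
    - exact: clone_proj.
  have := selfextensional_binary Cc sC seC (clone_comp Cc Cf Cs).
  rewrite !ffunE; congr (_ = _); congr (dm4_code (f _)).1 || congr (dm4_code (f _)).2;
  by apply/ffunP => i; rewrite !ffunE /s; case: (b i); rewrite !ffunE.
apply: (can_inj dm4_codeK); rewrite dm4_code_conf -/(conf_tuple a).
(* [key] at [a] and at [conf_tuple a] gives one coordinate of the equation each. *)
have := key a; have := key (conf_tuple a); rewrite conf_tupleK.
by move=> <- ->; case: dm4_code.
Qed.

Theorem mainTheorem17 (C : dmfamily) (C_clone : is_clone C)
    (DMA_C : family_sub DMA C) :
  (selfextensional C <-> family_sub C DMA_conf) /\
  (selfextensional C <-> (forall (n : nat) (f : dmfun n), C n f -> harmonious f)).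
Proof.
have seh : selfextensional C <-> (forall n (f : dmfun n), C n f -> harmonious f).
  split=> [seC n f | hC k l n h f g _ Cf Cg].
    exact: selfextensional_harmonious.
  by move/(harmonious_interderivable (hC _ _ Cf) (hC _ _ Cg)) ->; split.
split=> //; split=> [/seh.1 hC n f Cf | CD].
  by apply: harmonious_DMA_conf (hC _ _ Cf); apply: (clone_pos C_clone Cf).
by apply/seh.2 => n f /CD/DMA_conf_harmonious.
Qed.
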